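(* Let $X\subseteq\{0,1\}^n$, let $Q$ be a real symmetric $n\times n$ matrix with rows $Q_1,\dots,Q_n$, let $\bar X\subseteq\mathbb{R}^n$ be a relaxation of $X$, and for $i=1,\dots,n$ let $$\overline{\gamma}_1^i=\max\{Q_ix:x\in\bar X,\,x_i=0\},\qquad \underline{\gamma}_1^i=\min\{Q_ix:x\in\bar X,\,x_i=1\},$$ $$\overline{\gamma}_2^i=\max\{Q_ix:x\in\bar X,\,x_i=1\},\qquad \underline{\gamma}_2^i=\min\{Q_ix:x\in\bar X,\,x_i=0\}.$$ Then for every $x\in X$ and all $i=1,\dots,n$, $$x_iQ_ix=\max\{\underline{\gamma}_1^ix_i,\;Q_ix+\overline{\gamma}_1^ix_i-\overline{\gamma}_1^i\},$$ $$x_iQ_ix=\min\{\overline{\gamma}_2^ix_i,\;Q_ix+\underline{\gamma}_2^ix_i-\underline{\gamma}_2^i\}.$$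
   Context: A relaxation of $X$ is a set $\bar X\subseteq\mathbb{R}^n$ with $X\subseteq\bar X$; it is assumed that all the minima and maxima above exist (are attained and finite). $Q_i x$ denotes the scalar product of the $i$-th row of $Q$ with $x$. *)

(* Defs.v *)
(* MathComp, with the reals as an abstract [realType]. *)
From mathcomp Require Import all_boot all_order all_algebra.
From mathcomp Require Import boolp classical_sets reals.

Set Implicit Arguments.
Unset Strict Implicit.
Unset Printing Implicit Defensive.

Import Order.TTheory GRing.Theory Num.Theory.

Local Open Scope classical_set_scope.
Local Open Scope ring_scope.

Section Defs.
Variable R : realType.

(* Attained maximum / minimum: in contrast with [sup] and [inf], these assert
   that the extremum exists and belongs to the set. *)
Definition is_max (S : set R) (m : R) : Prop := S m /\ ubound S m.
Definition is_min (S : set R) (m : R) : Prop := S m /\ lbound S m.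

Variable n : nat.

Definition binary_vectors : set 'cV[R]_n :=
  [set x | forall i, x i 0 = 0 \/ x i 0 = 1].

Definition row_prod (Q : 'M[R]_n) (i : 'I_n) (x : 'cV[R]_n) : R :=
  (row i Q *m x) 0 0.

(* { Q_i x : x in Y, x_i = b } *)
Definition row_values (Q : 'M[R]_n) (Y : set 'cV[R]_n) (i : 'I_n) (b : R) :
    set R :=
  [set row_prod Q i x | x in [set x | Y x /\ x i 0 = b]].

End Defs.

(* Main.v *)
Require Import Defs.
From mathcomp Require Import all_boot all_order all_algebra.
From mathcomp Require Import boolp classical_sets reals.

Set Implicit Arguments.
Unset Strict Implicit.
Unset Printing Implicit Defensive.

Import Order.TTheory GRing.Theory Num.Theory.

Local Open Scope classical_set_scope.
Local Open Scope ring_scope.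

(** Since [x i 0] is 0 or 1, the product is 0 or [row_prod Q i x], and in each case one argument of
    [Num.max] and of [Num.min] equals it exactly. The other argument is on the correct side because
    [x] lies in [Xbar], hence competes in the extrema taken over the slice with its own value of
    [x i 0]. *)

Theorem lemma4p1 (R : realType) (n : nat) (X Xbar : set 'cV[R]_n)
    (Q : 'M[R]_n)
    (gamma1_max gamma1_min gamma2_max gamma2_min : 'I_n -> R)
    (X_binary : X `<=` @binary_vectors R n)
    (Q_sym : Q^T = Q)
    (X_relax : X `<=` Xbar)
    (gamma1_maxP : forall i, is_max (row_values Q Xbar i 0) (gamma1_max i))
    (gamma1_minP : forall i, is_min (row_values Q Xbar i 1) (gamma1_min i))
    (gamma2_maxP : forall i, is_max (row_values Q Xbar i 1) (gamma2_max i))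
    (gamma2_minP : forall i, is_min (row_values Q Xbar i 0) (gamma2_min i)) :
  forall x : 'cV[R]_n, X x -> forall i : 'I_n,
    x i 0 * row_prod Q i x =
      Num.max (gamma1_min i * x i 0)
              (row_prod Q i x + gamma1_max i * x i 0 - gamma1_max i) /\
    x i 0 * row_prod Q i x =
      Num.min (gamma2_max i * x i 0)
              (row_prod Q i x + gamma2_min i * x i 0 - gamma2_min i).
Proof.
move=> x Xx i.
have row_value : row_values Q Xbar i (x i 0) (row_prod Q i x).
  by exists x => //; split=> //; exact: X_relax.
(* [row_value] goes back into the goal so that the value of [x i 0] is also substituted in its slice
   index, matching the slices of the bounds. *)
case: (X_binary _ Xx i) row_value => -> row_value.
- have le_max := (gamma1_maxP i).2 _ row_value.
  have ge_min := (gamma2_minP i).2 _ row_value.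
  (* The first arguments vanish; the second ones are [row_prod Q i x] minus an upper, respectively a
     lower, bound. *)
  by rewrite mul0r !mulr0 !addr0 max_l ?min_l ?subr_le0 ?subr_ge0.
- have ge_min := (gamma1_minP i).2 _ row_value.
  have le_max := (gamma2_maxP i).2 _ row_value.
  (* The added and subtracted bounds cancel, so the second arguments are [row_prod Q i x] itself. *)
  by rewrite mul1r !mulr1 !addrK max_r ?min_r.
Qed.
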